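(* Let $(X,d)$ be a complete metric space, let $\psi,\phi:(0,\infty)\to\mathbb{R}$ be functions, and let $T:X\times X\to X$ be a map such that for all $z=(x,y)$, $w=(u,v)$ in $X\times X$ with $\max\{d(T(x,y),T(u,v)),\,d(T(y,x),T(v,u))\}>0$, $$\psi\big(d(Tz,Tw)\big)\le \phi\big(\max\{d(x,u),d(y,v)\}\big).$$ Suppose that: (i) $\phi(t)<\psi(t)$ for any $t>0$; (ii) $\inf_{t>\epsilon}\psi(t)>-\infty$ for any $\epsilon>0$; (iii) if $\{\psi(t_n)\}$ and $\{\phi(t_n)\}$ are convergent sequences with the same limit and $\{\psi(t_n)\}$ is strictly decreasing, then $t_n\to 0$ as $n\to\infty$; (iv) $\limsup_{t\to\epsilon+}\phi(t)<\liminf_{t\to\epsilon+}\psi(t)$ for any $\epsilon>0$; (v) $T$ has a closed graph, or $\limsup_{t\to0+}\phi(t)<\min\{\liminf_{t\to\epsilon}\psi(t),\psi(\epsilon)\}$ for any $\epsilon>0$. Then there exists a unique point $\xi^*=(x^*,y^* )\in X\times X$ such that $x^*=T(x^*,y^* )$ and $y^*=T(y^*,x^* )$, and the iterative sequences $x_n=T^n(x,y)$ and $y_n=T^n(y,x)$ converge to $x^*$ and $y^*$ respectively, for any $(x,y)\in X\times X$.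
   Context: For $T:X\times X\to X$ the iterates are defined by $T^1=T$ and $T^n(x,y)=T\big(T^{n-1}(x,y),T^{n-1}(y,x)\big)$ for $n\ge 2$. For $z=(x,y)$, $Tz$ means $T(x,y)$. In (iii), $\{t_n\}$ is a sequence in $(0,\infty)$. $T$ has a closed graph if $x_n\to x$, $y_n\to y$ and $T(x_n,y_n)\to\alpha$ in $X$ imply $T(x,y)=\alpha$. *)

(* Defs.v *)
From HB Require Import structures.
From mathcomp Require Import all_boot all_order all_algebra.
From mathcomp Require Import all_classical all_reals all_analysis.

Set Implicit Arguments.
Unset Strict Implicit.
Unset Printing Implicit Defensive.

Import Order.TTheory GRing.Theory Num.Theory.
Import numFieldNormedType.Exports.

Local Open Scope classical_set_scope.
Local Open Scope ring_scope.

(* [Complete] extends [isPointed], so these spaces are nonempty. *)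
#[short(type="completeMetricType")]
HB.structure Definition CompleteMetric (R : numDomainType) :=
  {M of Complete M & Metric R M}.

(* The value at n = 0 is a convention, chosen so that the recursion gives
   [coupled_iter T 1 x y = T x y]. *)
Fixpoint coupled_iter (X : Type) (T : X -> X -> X) (n : nat) (x y : X) : X :=
  if n is n'.+1 then T (coupled_iter T n' x y) (coupled_iter T n' y x) else x.

Definition coupled_fixed_point (X : Type) (T : X -> X -> X) (xi : X * X) :=
  xi.1 = T xi.1 xi.2 /\ xi.2 = T xi.2 xi.1.

Definition has_closed_graph (X : topologicalType) (T : X -> X -> X) :=
  forall (x_ y_ : nat -> X) (x y a : X),
    x_ @ \oo --> x -> y_ @ \oo --> y ->
    (fun n => T (x_ n) (y_ n)) @ \oo --> a ->
    T x y = a.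

(* [psi] and [phi] stand for functions on ]0, +oo[: only their values at
   positive arguments matter. The left-hand argument [mdist (T x y) (T u v)]
   can vanish although the maximum is positive; the inequality is then
   meaningless and is not required. *)
Definition coupled_contraction (R : realType) (X : metricType R)
    (psi phi : R -> R) (T : X -> X -> X) :=
  forall x y u v : X,
    0 < Num.max (mdist (T x y) (T u v)) (mdist (T y x) (T v u)) ->
    0 < mdist (T x y) (T u v) ->
    psi (mdist (T x y) (T u v)) <= phi (Num.max (mdist x u) (mdist y v)).

(* Main.v *)
(* Put the maximum metric on X * X: a coupled fixed point of T is a fixed point
   of F (x, y) = (T x y, T y x), which satisfies the one-variable condition
   psi (d (F z) (F w)) <= phi (d z w).

   For two orbits, t_n = d (F^n z) (F^n w) makes psi (t_n) strictly decreasing,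
   with phi (t_n) squeezed between psi (t_n.+1) and psi (t_n); hence t_n tends
   to 0, by (iii) if psi (t_n) is bounded below and by (ii) otherwise.

   By (iv) there is a band ]e, e + h[ on which phi (s) < psi (t) for all s, t, so
   a distance in the band cannot be followed by another distance in the band. If
   z_n = F^n z were not Cauchy, then for large n, m the numbers
   d (z_(n+k)) (z_(m+k)), k >= 0, would start above e + h, vary by less than
   h / 2 at each step and tend to 0, hence would take two successive values in
   the band. *)

Require Import Defs.
From HB Require Import structures.
From mathcomp Require Import all_boot all_order all_algebra.
From mathcomp Require Import all_classical all_reals all_analysis.
From mathcomp Require Import lra.

Import Order.TTheory GRing.Theory Num.Theory.
Import numFieldNormedType.Exports.

Local Open Scope classical_set_scope.
Local Open Scope ring_scope.

(** * The maximum metric on a product and its completeness *)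

Definition prod_mdist {R : realType} {X Y : metricType R} (z w : X * Y) : R :=
  Num.max (mdist z.1 w.1) (mdist z.2 w.2).

Lemma prod_mdist_ge0 {R : realType} {X Y : metricType R} (z w : X * Y) :
  0 <= prod_mdist z w.
Proof. by rewrite le_max mdist_ge0. Qed.

Lemma prod_mdist_positivity {R : realType} {X Y : metricType R} (z w : X * Y) :
  prod_mdist z w = 0 -> z = w.
Proof.
case: z w => [x y] [u v] /eqP; rewrite eq_le ge_max /= => /andP[/andP[xu yv] _].
by congr pair; apply: mdist_positivity; apply/eqP; rewrite eq_le mdist_ge0 andbT.
Qed.

(** A maximum is below [e] exactly when both terms are, so this metric induces the uniform structure
    that products already carry. *)
Lemma ballE_prod_mdist {R : realType} {X Y : metricType R}
    (z : X * Y) (e : R) :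
  ball z e = [set w | prod_mdist z w < e].
Proof.
apply/seteqP; split => w /=; rewrite /prod_mdist gt_max.
  rewrite /ball/= /prod_ball !ballEmdist.
  by move=> [/= -> ->].
by move=> /andP[]; rewrite /ball/= /prod_ball !ballEmdist.
Qed.

HB.instance Definition _ (R : realType) (X Y : metricType R) :=
  PseudoMetric_isMetric.Build R (X * Y)%type
    prod_mdist_ge0 prod_mdist_positivity ballE_prod_mdist.

(* Adds the joins of the pointed and uniform structures on products. *)
HB.saturate prod.

Lemma cauchy_fmap (U V : uniformType) (f : U -> V) (F : set_system U) :
  Filter F -> unif_continuous f -> cauchy F -> cauchy (f @ F).
Proof.
move=> FF f_unif F_cauchy A /f_unif /F_cauchy[[P Q] /= [FP FQ] PQ].
exists (f @` P, f @` Q); first by split;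
  [apply: filterS FP|apply: filterS FQ] => z ?; exists z.
by move=> [_ _] /= [[p Pp <-] [q Qq <-]]; exact: (PQ (p, q)).
Qed.

Lemma fst_unif_continuous (U V : uniformType) : unif_continuous (@fst U V).
Proof.
move=> A eA; exists (A, setT) => /=; first by split => //; exact: entourageT.
by move=> [[a b] [c d]] /= [Aab _]; exists ((a, c), (b, d)).
Qed.

Lemma snd_unif_continuous (U V : uniformType) : unif_continuous (@snd U V).
Proof.
move=> A eA; exists (setT, A) => /=; first by split => //; exact: entourageT.
by move=> [[a b] [c d]] /= [_ Acd]; exists ((a, c), (b, d)).
Qed.

Lemma prod_cauchy_cvg {X Y : completeType} (F : set_system (X * Y)) :
  ProperFilter F -> cauchy F -> cvg F.
Proof.
move=> FF F_cauchy.
have /cauchy_cvgP c1 : cauchy (fst @ F).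
  exact: cauchy_fmap (fst_unif_continuous X Y) F_cauchy.
have /cauchy_cvgP c2 : cauchy (snd @ F).
  exact: cauchy_fmap (snd_unif_continuous X Y) F_cauchy.
apply/cvg_ex; exists (lim (fst @ F), lim (snd @ F)).
have : (z.1, z.2) @[z --> F] --> (lim (fst @ F), lim (snd @ F)).
  exact: cvg_pair c1 c2.
by under eq_fun do rewrite -surjective_pairing.
Qed.

HB.instance Definition _ (X Y : completeType) :=
  Uniform_isComplete.Build (X * Y)%type prod_cauchy_cvg.

(* Adds the join of the complete and metric structures on products. *)
HB.saturate prod.

(** The upper limit is an infimum of suprema and the lower limit a supremum of infima, so a strict
    inequality between them is already witnessed by single sets [A] and [B]. *)
Lemma limf_esup_lt_limf_einf {R : realType} {U V : choiceType}
    {X : filteredType U} {Y : filteredType V} {f : X -> R} {g : Y -> R}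
    {F : set_system X} {G : set_system Y} :
  (limf_esup (EFin \o f) F < limf_einf (EFin \o g) G)%E ->
  exists A B, [/\ F A, G B & forall s t, A s -> B t -> f s < g t].
Proof.
rewrite limf_einfE => /ereal_inf_lt[_ [A FA <-]] /ereal_sup_gt[_ [B GB <-]] AB.
exists A, B; split => // s t As Bt; rewrite -lte_fin.
apply: le_lt_trans (lt_le_trans AB _).
  by apply: ereal_sup_ubound; exists s.
by apply: ereal_inf_lbound; exists t.
Qed.

Lemma limf_esup_lt_fin {R : realType} {U : choiceType} {X : filteredType U}
    {f : X -> R} {F : set_system X} {y : R} :
  (limf_esup (EFin \o f) F < y%:E)%E ->
  exists2 A, F A & forall s, A s -> f s < y.
Proof.
move=> /ereal_inf_lt[_ [A FA <-]] Ay; exists A => // s As.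
by rewrite -lte_fin; apply: le_lt_trans Ay; apply: ereal_sup_ubound; exists s.
Qed.

Lemma at_right_itv {R : realType} {e : R} {A : set R} :
  e^'+ A -> exists2 d : R, 0 < d & forall t, e < t < e + d -> A t.
Proof.
move=> [d /= d0 dA]; exists d => // t /andP[et td]; apply: dA => //=.
by rewrite ltr0_norm; lra.
Qed.

Lemma dnbhs_dist {R : realType} {e : R} {A : set R} :
  e^' A -> exists2 d : R, 0 < d & forall t, `|e - t| < d -> t != e -> A t.
Proof. by move=> [d /= d0 dA]; exists d => // t et te; exact: dA. Qed.

(** * Contractions in one variable *)

(** The sequence stands for the distances between two orbits; [t_eq0] covers orbits that meet, which
    then stay together. *)
Lemma psi_phi_seq_cvg0 (R : realType) (psi phi : R -> R) (t_ : nat -> R)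
    (phi_lt_psi : forall t : R, 0 < t -> phi t < psi t)
    (psi_inf : forall e : R, 0 < e ->
      (-oo < ereal_inf [set (psi t)%:E | t in `]e, +oo[])%E)
    (psi_phi_seq : forall (t_ : nat -> R) (l : R),
      (forall n, 0 < t_ n) ->
      (fun n => psi (t_ n)) @ \oo --> l ->
      (fun n => phi (t_ n)) @ \oo --> l ->
      (forall n, psi (t_ n.+1) < psi (t_ n)) ->
      t_ @ \oo --> 0)
    (t_ge0 : forall n, 0 <= t_ n)
    (t_eq0 : forall n, t_ n = 0 -> t_ n.+1 = 0)
    (t_psi : forall n, 0 < t_ n.+1 -> psi (t_ n.+1) <= phi (t_ n)) :
  t_ @ \oo --> 0.
Proof.
have [[n tn0]|tneq0] := pselect (exists n, t_ n = 0).
  apply: cvg_near_cst; exists n => // m /= nm.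
  by rewrite -(subnK nm); elim: (m - n)%N => [//|k IH]; exact: t_eq0.
have t_gt0 n : 0 < t_ n.
  by rewrite lt_neqAle t_ge0 andbT eq_sym; apply/eqP => tn0; apply: tneq0; exists n.
have psi_decr n : psi (t_ n.+1) < psi (t_ n).
  exact: le_lt_trans (t_psi _ (t_gt0 _)) (phi_lt_psi _ (t_gt0 _)).
have psi_mono : {homo (fun n => psi (t_ n)) : n m / (n <= m)%N >-> m <= n}.
  by apply/nonincreasing_seqP => n; exact: ltW.
have [lb|nlb] := pselect (has_lbound (range (fun n => psi (t_ n)))).
  have psi_cvg := nonincreasing_is_cvgn psi_mono lb.
  apply: (psi_phi_seq _ (limn (fun n => psi (t_ n)))) => //.
  apply: (@squeeze_cvgr _ _ _ _ (fun n => psi (t_ n.+1)) (fun n => psi (t_ n))) => //.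
    by apply: nearW => n; rewrite t_psi //= ltW // phi_lt_psi.
  by rewrite (cvg_shiftS (fun n => psi (t_ n))).
(* Here [psi (t_ n)] falls below a lower bound [M] of [psi] on ]e, +oo[ and stays there by
   monotonicity, so eventually [t_ n <= e]. *)
apply/cvgrPdist_le => e e0.
have [M psiM] : exists M, forall t, e < t -> M <= psi t.
  have := psi_inf e e0; set m := ereal_inf _ => m_gt.
  have mle t : e < t -> (m <= (psi t)%:E)%E.
    by move=> et; apply: ereal_inf_lbound; exists t => //=; rewrite in_itv /= et.
  (* The infimum is not -oo by [psi_inf] and is at most [psi t], so it is finite and [fine] keeps
     its value. *)
  exists (fine m) => t et; rewrite -lee_fin fineK ?mle //.
  by rewrite fin_numElt m_gt (le_lt_trans (mle t et)) // ltry.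
have [n nM] : exists n, psi (t_ n) < M.
  apply: contrapT => nM; apply: nlb; exists M => _ [n _ <-].
  by rewrite leNgt; apply/negP => ?; apply: nM; exists n.
exists n => // m /= nm; rewrite sub0r normrN ger0_norm // leNgt.
apply/negP => /psiM; rewrite leNgt => /negP; apply.
exact: le_lt_trans (psi_mono _ _ nm) nM.
Qed.

Definition metric_contraction {R : realType} {Z : metricType R}
    (psi phi : R -> R) (F : Z -> Z) :=
  forall z w : Z, 0 < mdist (F z) (F w) ->
    psi (mdist (F z) (F w)) <= phi (mdist z w).

Lemma orbit_cauchy (R : realType) (Z : metricType R) (psi phi : R -> R)
    (F : Z -> Z) (z : Z)
    (F_contr : metric_contraction psi phi F)
    (orbits : forall z w : Z,
      (fun n => mdist (iter n F z) (iter n F w)) @ \oo --> 0)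
    (limsup_lt_liminf : forall e : R, 0 < e ->
      (limf_esup (EFin \o phi) e^'+ < limf_einf (EFin \o psi) e^'+)%E) :
  cauchy ((fun n => iter n F z) @ \oo).
Proof.
(* It suffices to find one ball of radius [e0] containing a tail; [h <= e] with [e = e0 / 2] will
   put the band ]e, e + h[ below [e0]. *)
apply: cauchy_exP => e0 e00; pose e := e0 / 2.
have e_gt0 : 0 < e by rewrite /e; lra.
have [h [h_gt0 h_le band]] : exists h, [/\ 0 < h, h <= e &
    forall s t, e < s < e + h -> e < t < e + h -> phi s < psi t].
  have [A [B [/at_right_itv[a a0 aA] /at_right_itv[b b0 bB] AB]]] :=
    limf_esup_lt_limf_einf (limsup_lt_liminf e e_gt0).
  exists (Num.min e (Num.min a b)); split.
  - by rewrite !lt_min e_gt0 a0.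
  - by rewrite ge_min lexx.
  move=> s t /andP[es +] /andP[et +].
  rewrite -!ltrBlDl !lt_min => /and3P[_ sa _] /and3P[_ _ tb].
  by apply: AB; [apply: aA|apply: bB]; lra.
(* Each end of the distance [c j] will move by less than [h / 4], whence the bound [h / 2] per
   step. *)
have [N _ step] : \forall n \near \oo,
    mdist (iter n F z) (iter n F (F z)) < h / 4.
  have /cvgrPdist_lt/(_ (h / 4)) := orbits z (F z).
  move=> /(_ ltac:(lra)); apply: filterS => n.
  by rewrite sub0r normrN ger0_norm // mdist_ge0.
exists (iter N F z); exists N => // m /= Nm; rewrite ballEmdist /=.
rewrite ltNge; apply/negP => far.
pose c j := mdist (iter (j + N) F z) (iter (j + m) F z).
have c_step j : c j < c j.+1 + h / 2.
  have s1 := step (j + N)%N (leq_addl _ _).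
  have s2 := step (j + m)%N (leq_trans Nm (leq_addl _ _)).
  rewrite /c !addSn.
  have t1 := metric_triangle (iter (j + N) F z) (iter (j + N).+1 F z)
    (iter (j + m) F z).
  have t2 := metric_triangle (iter (j + N).+1 F z) (iter (j + m).+1 F z)
    (iter (j + m) F z).
  move: s1 s2 t1 t2; rewrite /= -!iterSr /= (metric_sym (F (iter (j + m) F z))); lra.
have c_big j : e + h / 2 < c j.
  elim: j => [|j IH].
    by rewrite /c !add0n; move: far h_le; rewrite /e; lra.
  have := c_step j.
  (* From [e + h] or above, a step cannot descend to [e + h / 2]. From inside the band, [c j.+1]
     still exceeds [e], so by [band] it must be at least [e + h]. *)
  have [cj_ge|cj_lt] := leP (e + h) (c j); first lra.
  move=> cS; suff : e + h <= c j.+1 by lra.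
  rewrite leNgt; apply/negP => cS_lt.
  have cS_gt0 : 0 < c j.+1 by lra.
  have := F_contr _ _ cS_gt0; rewrite leNgt => /negP; apply.
  by apply: band; rewrite -?/(c j) -?/(c j.+1); lra.
have /cvgrPdist_lt/(_ e e_gt0)[k _ /(_ k (leqnn k))] :=
  orbits (iter N F z) (iter m F z).
rewrite /= sub0r normrN ger0_norm ?mdist_ge0 // -!iterD -/(c k).
by have := c_big k; lra.
Qed.

Theorem contraction_fixed_point (R : realType) (Z : completeMetricType R)
    (psi phi : R -> R) (F : Z -> Z)
    (F_contr : metric_contraction psi phi F)
    (phi_lt_psi : forall t : R, 0 < t -> phi t < psi t)
    (psi_inf : forall e : R, 0 < e ->
      (-oo < ereal_inf [set (psi t)%:E | t in `]e, +oo[])%E)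
    (psi_phi_seq : forall (t_ : nat -> R) (l : R),
      (forall n, 0 < t_ n) ->
      (fun n => psi (t_ n)) @ \oo --> l ->
      (fun n => phi (t_ n)) @ \oo --> l ->
      (forall n, psi (t_ n.+1) < psi (t_ n)) ->
      t_ @ \oo --> 0)
    (limsup_lt_liminf : forall e : R, 0 < e ->
      (limf_esup (EFin \o phi) e^'+ < limf_einf (EFin \o psi) e^'+)%E)
    (closed_graph_or_limsup :
      (forall (z_ : nat -> Z) (z w : Z), z_ @ \oo --> z ->
        (F \o z_) @ \oo --> w -> F z = w) \/
      (forall e : R, 0 < e ->
        (limf_esup (EFin \o phi) 0^'+
         < Order.min (limf_einf (EFin \o psi) e^') (psi e)%:E)%E)) :
  exists xi : Z, unique (fun z => z = F z) xi /\
    forall z, (fun n => iter n F z) @ \oo --> xi.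
Proof.
have F_neq z w : 0 < mdist (F z) (F w) -> 0 < mdist z w.
  by rewrite !mdist_gt0; apply: contra_neq => ->.
have orbits z w : (fun n => mdist (iter n F z) (iter n F w)) @ \oo --> 0.
  apply: (psi_phi_seq_cvg0 R psi phi) => // n; first exact: mdist_ge0.
    by move=> /mdist_positivity /= ->; rewrite mdistxx.
  exact: F_contr.
have cvg_fix z xi : (fun n => iter n F z) @ \oo --> xi -> xi = F xi.
  move=> zxi.
  have Fzxi : (fun n => F (iter n F z)) @ \oo --> xi.
    by rewrite -(cvg_shiftS (fun n => iter n F z)) in zxi.
  case: closed_graph_or_limsup => [closedF|limsup0].
    by rewrite (closedF _ _ _ zxi Fzxi).
  (* If [e] were positive, the distance from [F (iter n F z)] to [F xi] would approach [e] while
     [iter n F z] approaches [xi], although [phi] near 0 lies below [psi] near [e]. *)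
  apply/eqP/negP => /negP; rewrite -mdist_gt0; set e := mdist _ _ => e_gt0.
  have := limsup0 e e_gt0; rewrite lt_min => /andP[].
  move=> /limf_esup_lt_limf_einf[A [B [/at_right_itv[a a0 aA]
    /dnbhs_dist[b b0 bB] AB]]].
  move=> /limf_esup_lt_fin[A' /at_right_itv[a' a'0 aA'] A'e].
  have phi_psi s t : 0 < s -> s < a -> s < a' -> `|e - t| < b ->
      phi s < psi t.
    (* The punctured neighbourhood omits [t = e], where the term [psi e] of the minimum serves. *)
    move=> s0 sa sa' etb; have [->|te] := eqVneq t e.
      by apply: A'e; apply: aA'; rewrite s0 add0r.
    by apply: AB; [apply: aA; rewrite s0 add0r|exact: bB].
  near \oo => n.
  have d1 : mdist xi (iter n F z) < Num.min a a'.
    near: n; apply: metricType_numDomainType.cvgr_dist_lt; first exact: zxi.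
    by rewrite lt_min a0.
  (* Below [e] to keep [F (iter n F z)] apart from [F xi], below [b] to keep their distance within
     [b] of [e]. *)
  have d2 : mdist xi (F (iter n F z)) < Num.min e b.
    near: n; apply: metricType_numDomainType.cvgr_dist_lt; first exact: Fzxi.
    by rewrite lt_min e_gt0.
  move: d1 d2; rewrite !lt_min => /andP[da da'] /andP[de db].
  have t1 := metric_triangle xi (F (iter n F z)) (F xi).
  have t2 := metric_triangle (F (iter n F z)) xi (F xi).
  rewrite [mdist (F (iter n F z)) xi]metric_sym -/e in t1 t2.
  have FF0 : 0 < mdist (F (iter n F z)) (F xi) by lra.
  have := F_contr _ _ FF0; rewrite leNgt => /negP; apply; apply: phi_psi.
  - exact: F_neq.
  - by rewrite metric_sym.
  - by rewrite metric_sym.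
  - by rewrite ltr_norml; lra.
have fix_uniq z w : z = F z -> w = F w -> z = w.
  move=> zF wF; apply/eqP/negP => /negP; rewrite -mdist_gt0 => zw.
  have := F_contr z w; rewrite -zF -wF => /(_ zw).
  by rewrite leNgt phi_lt_psi.
have cvg_orbit z : cvg ((fun n => iter n F z) @ \oo).
  by apply/cauchy_cvgP; apply: (orbit_cauchy R Z psi phi).
(* The base point is an arbitrary start: uniqueness of fixed points makes all orbit limits equal. *)
exists (lim ((fun n => iter n F point) @ \oo)); split.
  split; first exact: cvg_fix (cvg_orbit _).
  by move=> w wF; apply: fix_uniq => //; exact: cvg_fix (cvg_orbit _).
move=> z; rewrite (fix_uniq (lim _) (lim ((fun n => iter n F z) @ \oo))).
- exact: cvg_orbit.
- exact: cvg_fix (cvg_orbit _).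
- exact: cvg_fix (cvg_orbit _).
Unshelve. all: by end_near. Qed.

(** * Reduction of the coupled problem to one variable *)

Theorem theorem2p2 (R : realType) (X : completeMetricType R)
    (psi phi : R -> R) (T : X -> X -> X)
    (T_contr : coupled_contraction psi phi T)
    (phi_lt_psi : forall t : R, 0 < t -> phi t < psi t)
    (psi_inf : forall e : R, 0 < e ->
      (-oo < ereal_inf [set (psi t)%:E | t in `]e, +oo[])%E)
    (psi_phi_seq : forall (t_ : nat -> R) (l : R),
      (forall n, 0 < t_ n) ->
      (fun n => psi (t_ n)) @ \oo --> l ->
      (fun n => phi (t_ n)) @ \oo --> l ->
      (forall n, psi (t_ n.+1) < psi (t_ n)) ->
      t_ @ \oo --> 0)
    (limsup_lt_liminf : forall e : R, 0 < e ->
      (limf_esup (EFin \o phi) e^'+ < limf_einf (EFin \o psi) e^'+)%E)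
    (closed_graph_or_limsup : has_closed_graph T \/
      (forall e : R, 0 < e ->
        (limf_esup (EFin \o phi) 0^'+
         < Order.min (limf_einf (EFin \o psi) e^') (psi e)%:E)%E)) :
  exists xi : X * X,
    unique (coupled_fixed_point T) xi /\
    (forall x y : X,
      (fun n => coupled_iter T n x y) @ \oo --> xi.1 /\
      (fun n => coupled_iter T n y x) @ \oo --> xi.2).
Proof.
pose F (z : X * X) := (T z.1 z.2, T z.2 z.1).
have iterF n x y :
    iter n F (x, y) = (coupled_iter T n x y, coupled_iter T n y x).
  by elim: n => //= n ->.
have fixF z : (z = F z) <-> coupled_fixed_point T z.
  case: z => x y; rewrite /F /coupled_fixed_point /=.
  by split => [[xE yE]|[<- <-]].
have fst_cvg (z_ : nat -> X * X) (z : X * X) :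
    z_ @ \oo --> z -> (fst \o z_) @ \oo --> z.1.
  by case: z => x y zz; apply: (cvg_comp _ _ zz); exact: cvg_fst.
have snd_cvg (z_ : nat -> X * X) (z : X * X) :
    z_ @ \oo --> z -> (snd \o z_) @ \oo --> z.2.
  by case: z => x y zz; apply: (cvg_comp _ _ zz); exact: cvg_snd.
have F_contr : metric_contraction psi phi F.
  move=> [x y] [u v]; rewrite /mdist /= /prod_mdist /= => FF.
  (* The maximum is attained in one coordinate; if in the second, [T_contr] is used with both pairs
     swapped, which [maxC] undoes. *)
  move: (FF); case: (leP (mdist (T x y) (T u v))) => _ d0; last exact: T_contr.
  by rewrite [in phi _]maxC; apply: T_contr => //; rewrite maxC.
have [|xi [[/fixF xi_fix xi_uniq] xi_cvg]] := contraction_fixed_point R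
    (X * X)%type psi phi F F_contr phi_lt_psi psi_inf psi_phi_seq limsup_lt_liminf.
  case: closed_graph_or_limsup => [closedT|]; [left|by right].
  move=> z_ z w zz Fw; have z1 := fst_cvg _ _ zz; have z2 := snd_cvg _ _ zz.
  rewrite /F [RHS]surjective_pairing; congr pair.
    exact: closedT z1 z2 (fst_cvg _ _ Fw).
  exact: closedT z2 z1 (snd_cvg _ _ Fw).
exists xi; split; first by split => // w /fixF; exact: xi_uniq.
move=> x y; split.
  have := fst_cvg _ _ (xi_cvg (x, y)).
  by under eq_fun do rewrite /= iterF /=.
have := snd_cvg _ _ (xi_cvg (x, y)).
by under eq_fun do rewrite /= iterF /=.
Qed.
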